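(* Let $n\ge 1$ and let $\mathbf{y}\in\mathbb{R}^{n+1}$ be arbitrary. Then the procedure $\mathcal{N}$ described in the context, run on input $\mathbf{y}$, returns a vector $\mathbf{x}$ that is a nearest point of the lattice $A_n^*$ to $\mathbf{y}$, i.e. $\mathbf{x}\in A_n^*$ and $\|\mathbf{y}-\mathbf{x}\|\le\|\mathbf{y}-\mathbf{x}'\|$ for all $\mathbf{x}'\in A_n^*$. Moreover, the procedure requires $O(n\log n)$ arithmetic operations (as $n\to\infty$, with an implied constant independent of $\mathbf{y}$).
   Context: $\|\cdot\|$ is the Euclidean norm, $\mathbf{1}\in\mathbb{R}^{n+1}$ is the column vector of all ones, $\mathbf{I}$ is the $(n+1)\times(n+1)$ identity matrix, and $\mathbf{Q}=\mathbf{I}-\frac{\mathbf{1}\mathbf{1}^T}{n+1}$ is the orthogonal projection matrix onto the hyperplane orthogonal to $\mathbf{1}$. The lattice $A_n^*$ is $A_n^*=\{\mathbf{Q}\mathbf{k}\mid \mathbf{k}\in\mathbb{Z}^{n+1}\}\subset\mathbb{R}^{n+1}$. For a vector $\mathbf{y}$, $\lfloor\mathbf{y}\rceil$ denotes the vector obtained by rounding each element to a nearest integer; the direction of rounding of half-integers is immaterial (but $\lfloor\mathbf{y}\rceil$ denotes the same vector throughout one run of the procedure), e.g. half-integers may be rounded up. Procedure $\mathcal{N}$ (input $\mathbf{y}\in\mathbb{R}^{n+1}$): 1. Set $\mathbf{z}=\mathbf{y}-\lfloor\mathbf{y}\rceil$, $\alpha=\mathbf{z}^T\mathbf{1}$,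 $\beta=\mathbf{z}^T\mathbf{z}$. 2. By sorting, compute a permutation $(s_1,\dots,s_{n+1})$ of $(1,\dots,n+1)$ with $z_{s_1}\ge z_{s_2}\ge\dots\ge z_{s_{n+1}}$ (any such permutation if there are ties), using a sorting method that takes $O(n\log n)$ operations. 3. Set $D=\beta-\frac{\alpha^2}{n+1}$ and $m=0$. 4. For $i=1,\dots,n$ in order: replace $\alpha$ by $\alpha-1$; replace $\beta$ by $\beta-2z_{s_i}+1$; if $\beta-\frac{\alpha^2}{n+1}<D$, then set $D=\beta-\frac{\alpha^2}{n+1}$ and $m=i$. 5. Set $\mathbf{k}=\lfloor\mathbf{y}\rceil$; for $i=1,\dots,m$ replace $k_{s_i}$ by $k_{s_i}+1$. 6. Return $\mathbf{x}=\mathbf{k}-\frac{\mathbf{1}^T\mathbf{k}}{n+1}\mathbf{1}$. Complexity is counted in arithmetic operations: each addition, subtraction, multiplication, division, comparison, or rounding to a nearest integer of real numbers counts as one operation. *)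

(* Defs.v *)
From mathcomp Require Import all_boot all_order all_fingroup all_algebra.
From mathcomp Require Import all_classical all_reals all_analysis.

Set Implicit Arguments.
Unset Strict Implicit.
Unset Printing Implicit Defensive.

Import Order.TTheory GRing.Theory Num.Theory.
Import numFieldNormedType.Exports.

Local Open Scope ring_scope.
Local Open Scope classical_set_scope.

Section Lattice.
Variable R : realType.

(* The library norm on matrices is the sup norm. *)
Definition enorm n (v : 'cV[R]_n) : R := Num.sqrt (\sum_(i < n) v i 0 ^+ 2).

Definition ones n : 'cV[R]_n.+1 := const_mx 1.

Definition projQ n : 'M[R]_n.+1 := 1%:M - n.+1%:R^-1 *: (ones n *m (ones n)^T).

Definition An_star n : set 'cV[R]_n.+1 :=
  [set projQ n *m map_mx intr k | k in [set: 'cV[int]_n.+1]].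

Definition nearest_point n (L : set 'cV[R]_n) (y x : 'cV[R]_n) : Prop :=
  L x /\ forall x', L x' -> enorm (y - x) <= enorm (y - x').

End Lattice.

(* Programs computing an [A] from numbers of an abstract type [X].  A procedure
   that is polymorphic in [X] can inspect and combine its inputs only through
   the constructors below.  Integer literals and index bookkeeping are free;
   every other constructor costs one arithmetic operation. *)
Inductive arith_op := Add | Sub | Mul | Div.

Inductive prog (X A : Type) : Type :=
| Ret (a : A)
| Lit (m : nat) (k : X -> prog X A)
| Arith (o : arith_op) (u v : X) (k : X -> prog X A)
| Less (u v : X) (k : bool -> prog X A)
| Round (u : X) (k : X -> prog X A).

Arguments Ret {X A} a.

Fixpoint bind X A B (p : prog X A) (f : A -> prog X B) : prog X B :=
  match p with
  | Ret a => f a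
  | Lit m k => Lit m (fun x => bind (k x) f)
  | Arith o u v k => Arith o u v (fun x => bind (k x) f)
  | Less u v k => Less u v (fun b => bind (k b) f)
  | Round u k => Round u (fun x => bind (k x) f)
  end.

Declare Scope prog_scope.
Delimit Scope prog_scope with prog.
Notation "'let*' x ':=' p 'in' q" := (bind p (fun x => q))
  (at level 200, x binder, right associativity) : prog_scope.
Local Open Scope prog_scope.

Definition lit X (m : nat) : prog X X := Lit m Ret.
Definition add X (u v : X) : prog X X := Arith Add u v Ret.
Definition sub X (u v : X) : prog X X := Arith Sub u v Ret.
Definition mul X (u v : X) : prog X X := Arith Mul u v Ret.
Definition div X (u v : X) : prog X X := Arith Div u v Ret.
Definition less X (u v : X) : prog X bool := Less u v Ret.
Definition round X (u : X) : prog X X := Round u Ret.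

Fixpoint for_each X I A (s : seq I) (a : A) (body : A -> I -> prog X A) :
    prog X A :=
  if s is i :: s' then let* a' := body a i in for_each s' a' body else Ret a.

Definition set_entry X n (v : 'cV[X]_n) (i : 'I_n) (u : X) : 'cV[X]_n :=
  \col_j (if j == i then u else v j 0).

(* Replaces every entry [v i 0] by the result of [f i]. *)
Definition for_entries X n (v : 'cV[X]_n) (f : 'I_n -> prog X X) :
    prog X 'cV[X]_n :=
  for_each (enum 'I_n) v (fun w i => let* u := f i in Ret (set_entry w i u)).

Section Semantics.
Variable R : realType.

Definition eval_op (o : arith_op) (u v : R) : R :=
  match o with Add => u + v | Sub => u - v | Mul => u * v | Div => u / v end.

Definition nearest_int (u : R) (m : int) : Prop :=
  forall j : int, `|u - m%:~R| <= `|u - j%:~R|.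

(* [runs p c a]: some run of [p] performs exactly [c] operations and returns
   [a].  Each rounding of a half-integer may go either way. *)
Inductive runs (A : Type) : prog R A -> nat -> A -> Prop :=
| runs_ret a : runs (Ret a) 0 a
| runs_lit m k c a : runs (k m%:R) c a -> runs (Lit m k) c a
| runs_arith o u v k c a :
    runs (k (eval_op o u v)) c a -> runs (Arith o u v k) c.+1 a
| runs_less u v k c a : runs (k (u < v)) c a -> runs (Less u v k) c.+1 a
| runs_round u (m : int) k c a : nearest_int u m ->
    runs (k m%:~R) c a -> runs (Round u k) c.+1 a.

Definition is_O_nlogn (T : nat -> nat) : Prop :=
  (fun n => (T n)%:R : R) =O_\oo (fun n => n%:R * ln n%:R : R).

End Semantics.

Definition sorter := forall (X : Type) (n : nat), 'cV[X]_n -> prog X 'S_n.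

Definition sorts_decreasingly (R : realType) (sort : sorter) : Prop :=
  forall n (z : 'cV[R]_n) c s, runs (sort R n z) c s ->
  forall i j : 'I_n, (i <= j)%N -> z (s j) 0 <= z (s i) 0.

Definition sorts_in_O_nlogn (R : realType) (sort : sorter) : Prop :=
  exists2 T : nat -> nat, is_O_nlogn R T &
    forall n (z : 'cV[R]_n) c s, runs (sort R n z) c s -> (c <= T n)%N.

(* beta - alpha^2 / N *)
Definition defect X (N alpha beta : X) : prog X X :=
  let* t := mul alpha alpha in
  let* t' := div t N in
  sub beta t'.

(* Indices start at 0: the i-th pass of the main loop, for i = 1, ..., n, reads
   the entry s (i - 1). *)
Definition procN (sort : sorter) X n (y : 'cV[X]_n.+1) :
    prog X 'cV[X]_n.+1 :=
  let idx (i : 'I_n) : 'I_n.+1 := widen_ord (leqnSn n) i in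
  let* zero := lit X 0 in
  let* one := lit X 1 in
  let* two := lit X 2 in
  let* N := lit X n.+1 in
  let* r := for_entries y (fun i => round (y i 0)) in
  let* z := for_entries y (fun i => sub (y i 0) (r i 0)) in
  let* alpha0 := for_each (enum 'I_n.+1) zero (fun a i => add a (z i 0)) in
  let* beta0 := for_each (enum 'I_n.+1) zero (fun b i =>
    let* w := mul (z i 0) (z i 0) in add b w) in
  let* s := sort X n.+1 z in
  let* D0 := defect N alpha0 beta0 in
  let* final := for_each (enum 'I_n) (alpha0, beta0, D0, 0%N)
    (fun '(alpha, beta, D, m) i =>
      let* alpha' := sub alpha one in
      let* w := mul two (z (s (idx i)) 0) in
      let* b := sub beta w in
      let* beta' := add b one in
      let* d := defect N alpha' beta' in
      let* smaller := less d D in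
      Ret (if smaller then (alpha', beta', d, i.+1)
           else (alpha', beta', D, m))) in
  let m := final.2 in
  let* k := for_each (take m (enum 'I_n)) r (fun k i =>
    let* u := add (k (s (idx i)) 0) one in
    Ret (set_entry k (s (idx i)) u)) in
  let* sum := for_each (enum 'I_n.+1) zero (fun a i => add a (k i 0)) in
  let* mean := div sum N in
  for_entries k (fun i => sub (k i 0) mean).

(* Main.v *)
(** The squared distance from [y] to [Q k] is, up to a constant depending only
    on [y], the squared distance from [y - k] to the line spanned by [ones].
    With [z] the rounding residue of [y], minimizing over integral [k] thus
    means minimizing over an integral [u] and a real [d] the squared norm of
    [z + d *: ones - u].  Translating [u] along [ones] one may take [d] in
    [0, 1], where the best [u] for a given [d] is the indicator of the entries
    of [z] that are at least [1/2 - d], hence of a prefix of the sorted order.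
    The procedure tries all these prefixes, except the full one, which is
    equivalent to the empty one. *)

Require Import Defs.
From mathcomp Require Import all_boot all_order all_fingroup all_algebra.
From mathcomp Require Import all_classical all_reals all_analysis.
From mathcomp Require Import ring lra zify.

Import Order.TTheory GRing.Theory Num.Theory.

Local Open Scope ring_scope.

(** * Cost and postcondition calculus for programs *)

(** Half-integers may round either way, so the triple speaks of all runs at once. [C] is an upper
    bound rather than the exact cost because runs may differ in length. *)
Definition spec {R : realType} {A : Type} (p : prog R A) (C : nat)
    (Q : A -> Prop) : Prop :=
  forall c a, runs p c a -> (c <= C)%N /\ Q a.

Lemma nearest_int_exists (R : realType) (u : R) : exists m, nearest_int u m.
Proof.
exists (Num.floor (u + 2^-1)) => j.
set m := Num.floor _.
have /andP[m1 m2] := floor_itv (u + 2^-1); rewrite -/m intrD in m1 m2.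
have um : `|u - m%:~R| <= 2^-1 by rewrite ler_norml; lra.
case: (ltrgtP j m) => [jm|mj|->//]; apply: (le_trans um).
- have : j%:~R + 1 <= m%:~R :> R.
    by rewrite -[1]/(1%:~R) -intrD ler_int; lia.
  by move=> ?; rewrite ler_normr; apply/orP; left; lra.
- have : m%:~R + 1 <= j%:~R :> R.
    by rewrite -[1]/(1%:~R) -intrD ler_int; lia.
  by move=> ?; rewrite ler_normr; apply/orP; right; lra.
Qed.

Lemma nearest_int_bound (R : realType) (u : R) (m : int) :
  nearest_int u m -> -2^-1 <= u - m%:~R <= 2^-1.
Proof.
move=> um; have := um (m + 1); have := um (m - 1).
rewrite !intrD mulrN1z; set x := u - _.
have -> : u - (m%:~R - 1) = x + 1 by rewrite /x; ring.
have -> : u - (m%:~R + 1%:~R) = x - 1 by rewrite /x; ring.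
by case: (ger0P x); case: (ger0P (x + 1)); case: (ger0P (x - 1)); lra.
Qed.

(** Guards against vacuity: [spec] says nothing about a program without runs. Only a rounding could
    block, and a nearest integer always exists. *)
Lemma runs_total (R : realType) A (p : prog R A) : exists c a, runs p c a.
Proof.
elim: p => [a|m k IH|o u v k IH|u v k IH|u k IH].
- by exists 0%N, a; constructor.
- by have [c [a ?]] := IH m%:R; exists c, a; constructor.
- by have [c [a ?]] := IH (eval_op o u v); exists c.+1, a; constructor.
- by have [c [a ?]] := IH (u < v); exists c.+1, a; constructor.
- have [m um] := nearest_int_exists _ u.
  by have [c [a ?]] := IH m%:~R; exists c.+1, a; apply: runs_round um _.
Qed.

Lemma spec_ret (R : realType) A (a : A) C (Q : A -> Prop) :
  Q a -> spec (Ret a : prog R A) C Q.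
Proof. by move=> Qa c b H; inversion H; subst. Qed.

Lemma spec_lit (R : realType) A m (k : R -> prog R A) C Q :
  spec (k m%:R) C Q -> spec (Lit m k) C Q.
Proof. by move=> Hk c b H; inversion H; subst; apply: Hk. Qed.

Lemma spec_arith (R : realType) A o u v (k : R -> prog R A) C Q :
  spec (k (eval_op o u v)) C Q -> spec (Arith o u v k) C.+1 Q.
Proof. by move=> Hk c b H; inversion H; subst; rewrite ltnS; apply: Hk. Qed.

Lemma spec_less (R : realType) A (u v : R) (k : bool -> prog R A) C Q :
  spec (k (u < v)) C Q -> spec (Less u v k) C.+1 Q.
Proof. by move=> Hk c b H; inversion H; subst; rewrite ltnS; apply: Hk. Qed.

Lemma spec_round (R : realType) A (u : R) (k : R -> prog R A) C Q :
  (forall m : int, nearest_int u m -> spec (k m%:~R) C Q) ->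
  spec (Round u k) C.+1 Q.
Proof.
by move=> Hk c b H; inversion H; subst; rewrite ltnS; apply: Hk.
Qed.

Lemma runs_bind (R : realType) A B (p : prog R A) (f : A -> prog R B) c b :
  runs (bind p f) c b ->
  exists c1 a c2, [/\ c = (c1 + c2)%N, runs p c1 a & runs (f a) c2 b].
Proof.
elim: p c => [a|m k IH|o u v k IH|u v k IH|u k IH] c /= H;
  first by exists 0%N, a, c; split => //; constructor.
all: inversion H; subst; match goal with
  | Hk : runs (bind _ _) _ _ |- _ => have [c1 [a [c2 [-> ? ?]]]] := IH _ _ Hk
  end.
1: by exists c1, a, c2; split => //; constructor.
all: exists c1.+1, a, c2; split => //; econstructor; eassumption.
Qed.

Lemma spec_bind {R : realType} {A B} {p : prog R A} {f : A -> prog R B}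
    {C1 C2 P Q} :
  spec p C1 P -> (forall a, P a -> spec (f a) C2 Q) ->
  spec (bind p f) (C1 + C2) Q.
Proof.
move=> Hp Hf c b H.
have [c1 [a [c2 [-> Hc1 Hc2]]]] := runs_bind _ _ _ _ _ _ _ H.
have [le1 Pa] := Hp _ _ Hc1; have [le2 Qb] := Hf _ Pa _ _ Hc2.
by split=> //; exact: leq_add.
Qed.

Lemma spec_le {R : realType} {A} {p : prog R A} {C1 C2 Q} :
  spec p C1 Q -> (C1 <= C2)%N -> spec p C2 Q.
Proof.
move=> Hp le12 c a H; have [le1 Qa] := Hp _ _ H.
by split=> //; exact: leq_trans le12.
Qed.

(** The indices start at an arbitrary [j] so that the induction can pass to the tail of the list. *)
Lemma spec_for_each_iota (R : realType) n A (s : seq 'I_n) j (a : A)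
    (body : A -> 'I_n -> prog R A) C (Inv : nat -> A -> Prop) :
  map val s = iota j (size s) ->
  (forall (i : 'I_n) a, Inv i a -> spec (body a i) C (Inv i.+1)) ->
  Inv j a ->
  spec (for_each s a body) (size s * C) (Inv (j + size s)%N).
Proof.
move=> + Hbody; elim: s j a => [|i s IH] j a /=.
  by rewrite addn0 => _ ?; apply: spec_ret.
case=> <- Hs Ha; rewrite mulSn addnS -addSn.
by apply: spec_bind (Hbody _ _ Ha) _ => b; exact: IH.
Qed.

Lemma spec_for_each_take {R : realType} {n A m} {a : A}
    {body : A -> 'I_n -> prog R A} {C} (Inv : nat -> A -> Prop) :
  (m <= n)%N ->
  (forall (i : 'I_n) a, Inv i a -> spec (body a i) C (Inv i.+1)) ->
  Inv 0%N a ->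
  spec (for_each (take m (enum 'I_n)) a body) (m * C) (Inv m).
Proof.
move=> lemn Hbody Ha.
have sz : size (take m (enum 'I_n)) = m.
  by rewrite size_takel // size_enum_ord.
have := spec_for_each_iota _ _ _ (take m (enum 'I_n)) 0 a body C Inv.
rewrite sz; apply => //.
by rewrite map_take val_enum_ord take_iota (minn_idPl lemn).
Qed.

Lemma spec_for_each_enum {R : realType} {n A} {a : A}
    {body : A -> 'I_n -> prog R A} {C} (Inv : nat -> A -> Prop) :
  (forall (i : 'I_n) a, Inv i a -> spec (body a i) C (Inv i.+1)) ->
  Inv 0%N a ->
  spec (for_each (enum 'I_n) a body) (n * C) (Inv n).
Proof.
move=> Hbody Ha; have -> : enum 'I_n = take n (enum 'I_n).
  by rewrite take_oversize // size_enum_ord.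
exact: spec_for_each_take.
Qed.

Lemma spec_for_entries {R : realType} {n} {v : 'cV[R]_n}
    {f : 'I_n -> prog R R} {C} (P : 'I_n -> R -> Prop) :
  (forall i, spec (f i) C (P i)) ->
  spec (for_entries v f) (n * C) (fun w => forall i, P i (w i 0)).
Proof.
move=> Hf; rewrite /for_entries.
pose Inv j (w : 'cV[R]_n) := forall i : 'I_n, (i < j)%N -> P i (w i 0).
suff H : spec (for_entries v f) (n * C) (Inv n).
  by move=> c w Hr; have [? Hw] := H _ _ Hr; split => // i; exact: Hw.
apply: spec_for_each_enum => // i w Hw.
rewrite -[C]addn0; apply: spec_bind (Hf i) _ => a Pa.
apply: spec_ret => l; rewrite ltnS leq_eqVlt mxE => li.
case: eqP => [->//|nli]; apply: Hw.
by case/orP: li => // /eqP/val_inj.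
Qed.

Lemma sum_ord_ltS (V : zmodType) n (F : 'I_n -> V) (i : 'I_n) :
  \sum_(l < n | (l < i.+1)%N) F l = \sum_(l < n | (l < i)%N) F l + F i.
Proof.
rewrite (bigD1 i) //= addrC; congr (_ + _); apply: eq_bigl => l.
by rewrite ltnS ltn_neqAle andbC.
Qed.

Lemma spec_for_each_sum {R : realType} {n} {a : R}
    {body : R -> 'I_n -> prog R R} {C} (F : 'I_n -> R) :
  (forall i b, spec (body b i) C (fun b' => b' = b + F i)) ->
  spec (for_each (enum 'I_n) a body) (n * C) (fun b => b = a + \sum_i F i).
Proof.
move=> Hbody.
pose Inv j b := b = a + \sum_(l < n | (l < j)%N) F l.
have -> : \sum_i F i = \sum_(l < n | (l < n)%N) F l.
  by apply: eq_bigl => l; rewrite ltn_ord.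
apply: (spec_for_each_enum Inv) => [i b ->|].
  move=> c b' Hr; have [? ->] := Hbody _ _ _ _ Hr.
  by rewrite /Inv sum_ord_ltS addrA.
by rewrite /Inv big_pred0 ?addr0.
Qed.

(** * Distances modulo the line spanned by [ones] *)

(* [qdist v] is the squared norm of [projQ n *m v]. *)
Definition qdist {R : realType} {n} (v : 'cV[R]_n.+1) : R :=
  \sum_i v i 0 ^+ 2 - (\sum_i v i 0) ^+ 2 / n.+1%:R.

Lemma sum_sqr_addr (R : realType) n (v : 'cV[R]_n.+1) (d : R) :
  \sum_i (v i 0 + d) ^+ 2 =
  \sum_i v i 0 ^+ 2 + 2 * d * (\sum_i v i 0) + n.+1%:R * d ^+ 2.
Proof.
under eq_bigr => i _ do rewrite sqrrD.
rewrite !big_split /= sumr_const card_ord -[_ *+ n.+1]mulr_natl.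
by rewrite -mulr_suml; ring.
Qed.

(** Pythagoras: [v + d *: ones] splits into the projection of [v], independent of [d], and a
    multiple of [ones]. Each use chooses its own [d]. *)
Lemma qdistE (R : realType) n (v : 'cV[R]_n.+1) (d : R) :
  qdist v = \sum_i (v i 0 + d) ^+ 2
    - n.+1%:R * (d + (\sum_i v i 0) / n.+1%:R) ^+ 2.
Proof.
by rewrite sum_sqr_addr /qdist; field; rewrite nat1r.
Qed.

Lemma projQE (R : realType) n (v : 'cV[R]_n.+1) (i : 'I_n.+1) :
  (projQ R n *m v) i 0 = v i 0 - (\sum_j v j 0) / n.+1%:R.
Proof.
rewrite mulmxBl mul1mx -scalemxAl !mxE mulrC; congr (_ - _ / _).
apply: eq_bigr => j _.
by rewrite !mxE big_ord1 !mxE !mul1r.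
Qed.

Lemma enorm_sub_projQ (R : realType) n (y v : 'cV[R]_n.+1) :
  enorm (y - projQ R n *m v) =
  Num.sqrt (qdist (y - v) + (\sum_i y i 0) ^+ 2 / n.+1%:R).
Proof.
congr Num.sqrt.
(* Shifting by the mean of [v] turns the entries of [y - v] into those of [y - projQ R n *m v]. *)
rewrite (qdistE _ _ _ ((\sum_j v j 0) / n.+1%:R)).
have -> : \sum_i (y - v) i 0 = \sum_i y i 0 - \sum_i v i 0.
  by rewrite -sumrB; apply: eq_bigr => i _; rewrite !mxE.
rewrite -[LHS]addr0 -addrA; congr (_ + _).
  apply: eq_bigr => i _.
  have -> : (y - projQ R n *m v) i 0 = y i 0 - (projQ R n *m v) i 0.
    by rewrite !mxE.
  by rewrite projQE !mxE; congr (_ ^+ 2); ring.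
by field; rewrite nat1r.
Qed.

(** * Optimality of the prefixes of the sorted order *)

(** As [z + d] lies between -1/2 and 3/2, either 0 or 1 is a nearest integer to it, with the change
    at 1/2. *)
Lemma round_zero_one_le (R : realType) (z d : R) (u : int) :
  -2^-1 <= z <= 2^-1 -> 0 <= d <= 1 ->
  (z + d - (2^-1 - d <= z)%R%:R) ^+ 2 <= (z + d - u%:~R) ^+ 2.
Proof.
move=> hz hd; rewrite -subr_ge0.
case: (lerP (2^-1 - d) z) => zd /=.
  (* The factors never have opposite signs: both are nonnegative for [u <= 0], the first vanishes at
     1, and both are nonpositive for [u >= 2]. *)
  have -> : (z + d - u%:~R) ^+ 2 - (z + d - 1%:R) ^+ 2 =
      (1 - u%:~R) * (2 * (z + d) - u%:~R - 1) :> R by ring.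
  have [u1|u1] := lerP u 0.
    have ? : u%:~R <= 0 :> R by rewrite lerz0.
    by apply: mulr_ge0; lra.
  have : (u == 1) || (2 <= u) by lia.
  case/orP => [/eqP ->|u2]; first by rewrite subrr mul0r.
  have ? : 2%:~R <= u%:~R :> R by rewrite ler_int.
  by rewrite nmulr_rge0; lra.
have -> : (z + d - u%:~R) ^+ 2 - (z + d - 0%:R) ^+ 2 =
    u%:~R * (u%:~R - 2 * (z + d)) :> R by ring.
have [u1|u1] := lerP 1 u.
  have ? : 1%:~R <= u%:~R :> R by rewrite ler_int.
  by apply: mulr_ge0; lra.
have : (u == 0) || (u <= -1) by lia.
case/orP => [/eqP ->|u2]; first by rewrite mul0r.
have ? : u%:~R <= (-1)%:~R :> R by rewrite ler_int.
by rewrite nmulr_rge0; lra.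
Qed.

Lemma downclosed_ord n (P : pred 'I_n) :
  (forall i j : 'I_n, (i <= j)%N -> P j -> P i) ->
  exists2 m, (m <= n)%N & forall i : 'I_n, P i = (i < m)%N.
Proof.
move=> Pdown; pose B m := [forall i : 'I_n, P i ==> (i < m)%N].
have Bn : B n by apply/forallP => i; rewrite ltn_ord implybT.
have [m Bm minm] := ex_minnP (ex_intro B n Bn).
exists m; first exact: minm.
move=> i; apply/idP/idP; first by apply/implyP; move/forallP: Bm; apply.
(* Minimality of the bound [m.+1] gives an element of [P] at index [m] or later; closure then
   reaches [i]. *)
case: m Bm minm => // m _ minm; rewrite ltnS => im.
have : ~~ B m by apply/negP => /minm; rewrite ltnn.
case/forallPn => j; rewrite negb_imply -leqNgt => /andP[Pj mj].
exact: Pdown (leq_trans im mj) Pj.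
Qed.

(** [s^-1 l] is the position of entry [l] in the sorted order. The ring varies because the vector
    serves both as a real displacement and as integer lattice coordinates. *)
Definition prefix_mx (V : nzRingType) {n} (s : 'S_n) (m : nat) : 'cV[V]_n :=
  \col_l ((s^-1%g l < m)%N)%:R.

(** The full and the empty prefix differ by [ones], which the projection kills; the shifts 1 and 0
    make the two sums of squares coincide. *)
Lemma qdist_prefix_full (R : realType) n (z : 'cV[R]_n.+1) (s : 'S_n.+1) :
  qdist (z - prefix_mx R s n.+1) = qdist (z - prefix_mx R s 0).
Proof.
rewrite (qdistE _ _ _ 1) (qdistE _ _ (_ - prefix_mx R s 0) 0).
have e0 i : (z - prefix_mx R s 0) i 0 = z i 0 by rewrite !mxE subr0.
have e1 i : (z - prefix_mx R s n.+1) i 0 = z i 0 - 1.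
  by rewrite !mxE ltn_ord.
under eq_bigr => i _ do rewrite e1 subrK.
under [X in _ = X - _]eq_bigr => i _ do rewrite e0 addr0.
congr (_ - _ * _ ^+ 2).
rewrite (eq_bigr _ (fun i _ => e1 i)) (eq_bigr _ (fun i _ => e0 i)).
rewrite sumrB sumr_const card_ord.
by field; rewrite nat1r.
Qed.

Lemma qdist_prefix_min (R : realType) n (z : 'cV[R]_n.+1) (s : 'S_n.+1)
    (u : 'cV[int]_n.+1) :
  (forall i, -2^-1 <= z i 0 <= 2^-1) ->
  (forall i j : 'I_n.+1, (i <= j)%N -> z (s j) 0 <= z (s i) 0) ->
  exists2 m, (m <= n)%N &
    qdist (z - prefix_mx R s m) <= qdist (z - map_mx intr u).
Proof.
move=> hz hs.
(* [c] is the mean of [z - u], so [- c] is the best shift along [ones]. Adding the integer [p] to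
   [u] replaces this shift by [d], which lies in [0, 1]. *)
pose c : R := (\sum_i (z - map_mx intr u) i 0) / n.+1%:R.
pose p := Num.floor c + 1; pose d := p%:~R - c.
have hd : 0 <= d <= 1.
  have /andP[c1 c2] := floor_itv c.
  by rewrite /d /p; rewrite !intrD in c1 c2 *; lra.
have [i j ij|m lemn hm] := downclosed_ord _ (fun t => 2^-1 - d <= z (s t) 0).
  by move=> h; apply: le_trans h _; exact: hs.
have hprefix : qdist (z - prefix_mx R s m) <= qdist (z - map_mx intr u).
  (* With the shift [- c] the subtracted square vanishes on the right; on the left, with shift [d],
     it is dropped. What remains is compared entry by entry. *)
  rewrite (qdistE _ _ (_ - map_mx _ _) (- c)) addNr expr0n mulr0 subr0.
  rewrite (qdistE _ _ _ d) lerBlDr.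
  apply: ler_wpDr; first by rewrite mulr_ge0 ?sqr_ge0 ?ler0n.
  apply: ler_sum => i _; rewrite !mxE -hm permKV.
  have := round_zero_one_le _ (z i 0) d (u i 0 + p) (hz i) hd.
  rewrite intrD; congr (_ ^+ 2 <= _ ^+ 2); rewrite /d; ring.
(* The loop stops at [n], so a full prefix is traded for the empty one. *)
have [leqmn|] := leqP m n; first by exists m.
move=> ltnm; exists 0%N => //.
have em : m = n.+1 by apply/eqP; rewrite eqn_leq lemn.
by move: hprefix; rewrite em qdist_prefix_full.
Qed.

(** * Passing from one prefix to the next *)

Lemma prefix_mxS (V : nzRingType) n (s : 'S_n) (j l : 'I_n) :
  prefix_mx V s j.+1 l 0 = prefix_mx V s j l 0 + (l == s j)%:R.
Proof.
have -> : (l == s j) = (s^-1%g l == j).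
  by apply/eqP/eqP => [->|<-]; rewrite ?permK ?permKV.
rewrite !mxE ltnS leq_eqVlt -val_eqE /=.
by case: eqP => [->|_] /=; rewrite ?ltnn ?add0r ?addr0.
Qed.

Lemma sub_prefix_mxS (R : realType) n (z : 'cV[R]_n) (s : 'S_n)
    (j l : 'I_n) :
  (z - prefix_mx R s j.+1) l 0 =
  (z - prefix_mx R s j) l 0 - (l == s j)%:R.
Proof.
have e m : (z - prefix_mx R s m) l 0 = z l 0 - prefix_mx R s m l 0.
  by rewrite !mxE.
by rewrite !e prefix_mxS opprD addrA.
Qed.

Lemma sum_prefixS (R : realType) n (z : 'cV[R]_n) (s : 'S_n) (j : 'I_n) :
  \sum_i (z - prefix_mx R s j.+1) i 0 = \sum_i (z - prefix_mx R s j) i 0 - 1.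
Proof.
rewrite (eq_bigr _ (fun i _ => sub_prefix_mxS R n z s j i)) sumrB.
congr (_ - _); rewrite (bigD1 (s j)) //= eqxx big1 ?addr0 // => i.
by move/negbTE ->.
Qed.

(** Justifies the update of beta: only the entry at [s j] changes, from [z (s j) 0] to one less. *)
Lemma sum_sqr_prefixS (R : realType) n (z : 'cV[R]_n) (s : 'S_n) (j : 'I_n) :
  \sum_i (z - prefix_mx R s j.+1) i 0 ^+ 2 =
  \sum_i (z - prefix_mx R s j) i 0 ^+ 2 - 2 * z (s j) 0 + 1.
Proof.
have zj : (z - prefix_mx R s j) (s j) 0 = z (s j) 0.
  by rewrite !mxE permK ltnn subr0.
rewrite (bigD1 (s j)) // [in RHS](bigD1 (s j)) //=.
rewrite sub_prefix_mxS eqxx zj mulr1n.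
rewrite (eq_bigr (fun i => (z - prefix_mx R s j) i 0 ^+ 2)); first by ring.
by move=> i /negbTE ne; rewrite sub_prefix_mxS ne subr0.
Qed.

(** * Growth of the cost bound *)

Lemma is_O_nlogn_succ (R : realType) (T : nat -> nat) (a : nat) :
  is_O_nlogn R T -> is_O_nlogn R (fun n => T n.+1 + a * n.+1)%N.
Proof.
rewrite /is_O_nlogn => /eqO_exP[k k0 [N _ HN]]; apply/eqO_exP.
have ln2 : 0 < ln 2 :> R by rewrite ln_gt0 // ltr1n.
(* For [n >= 2], both [n + 1 <= 2 * n] and [ln (n + 1) <= 2 * ln n] hold, whence the factor 4. The
   linear term is absorbed by [ln n / ln 2 >= 1]. *)
exists (4 * k + 2 * a%:R / ln 2).
  by apply: ltr_wpDr; [rewrite divr_ge0 ?mulr_ge0 ?ler0n // ltW | lra].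
exists (maxn N 2) => // n /=; rewrite geq_max => /andP[leNn le2n].
have := HN n.+1 (leq_trans leNn (leqnSn n)).
rewrite !ger0_norm ?mulr_ge0 ?ler0n ?ln_ge0 ?ler1n ?(leq_trans _ le2n) // => hT.
rewrite natrD natrM.
have n0 : 0 < n%:R :> R by rewrite ltr0n (leq_trans _ le2n).
have leS : n.+1%:R <= 2 * n%:R :> R.
  by rewrite -natrM ler_nat; lia.
have ln_n : ln 2 <= ln n%:R :> R.
  by rewrite ler_ln ?posrE ?ler_nat.
have lnS : ln n.+1%:R <= 2 * ln n%:R :> R.
  rewrite mulr_natl -lnXn // ler_ln ?posrE ?exprn_gt0 //.
  by rewrite -natrX ler_nat; nia.
rewrite mulrDl; apply: lerD.
  apply: le_trans hT _; rewrite [4 * k]mulrC -mulrA ler_pM2l //.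
  have -> : 4 * (n%:R * ln n%:R) = (2 * n%:R) * (2 * ln n%:R) :> R by ring.
  by apply: ler_pM; rewrite ?ler0n ?ln_ge0 ?ler1n.
have -> : 2 * a%:R / ln 2 * (n%:R * ln n%:R) =
    a%:R * (2 * n%:R * (ln n%:R / ln 2)) :> R by ring.
rewrite ler_wpM2l ?ler0n // (le_trans leS) // ler_peMr ?mulr_ge0 ?ler0n //.
by rewrite ler_pdivlMr // mul1r.
Qed.

(** * Correctness and cost of the procedure *)

Lemma procN_spec (R : realType) (sort : sorter) (t n : nat)
    (y : 'cV[R]_n.+1) :
  sorts_decreasingly R sort ->
  (forall (z : 'cV[R]_n.+1) c s, runs (sort R n.+1 z) c s -> (c <= t)%N) ->
  spec (procN sort y) (t + 16 * n.+1) (nearest_point (@An_star R n) y).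
Proof.
move=> sortP sort_cost.
(* In program order: rounding, residue, alpha, beta, sorting; then 3 for the first defect, 8 per
   pass, at most [n] increments, the sum, the division and the final subtractions. *)
pose C := (n.+1 * 1 + (n.+1 * 1 + (n.+1 * 1 + (n.+1 * 2 + (t +
  (n * 8 + (n * 1 + (n.+1 * 1 + (n.+1 * 1).+1))).+3)))))%N.
apply: (@spec_le _ _ _ C); last by rewrite /C; lia.
rewrite {}/C /procN /=.
do 4 apply: spec_lit.
apply: (spec_bind (P := fun r : 'cV[R]_n.+1 =>
  forall i, exists2 m, nearest_int (y i 0) m & r i 0 = m%:~R)).
  apply: (spec_for_entries
    (fun i x => exists2 m, nearest_int (y i 0) m & x = m%:~R)) => i.
  by apply: spec_round => m ym; apply: spec_ret; exists m.
(* [rho] collects the integers chosen in this run; both [z] and [k] are built on it. *)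
move=> r /fin_all_exists2[rho rhoP rE].
apply: (spec_bind (P := fun z : 'cV[R]_n.+1 =>
  forall i, z i 0 = y i 0 - r i 0)).
  apply: (spec_for_entries (fun i x => x = y i 0 - r i 0)) => i.
  by apply: spec_arith; apply: spec_ret.
move=> z zE.
have z_bound i : -2^-1 <= z i 0 <= 2^-1.
  by rewrite zE rE; exact: nearest_int_bound.
apply: (spec_bind (P := fun b => b = 0 + \sum_i z i 0)).
  apply: spec_for_each_sum => i b.
  by apply: spec_arith; apply: spec_ret.
move=> _ ->.
apply: (spec_bind (P := fun b => b = 0 + \sum_i z i 0 ^+ 2)).
  apply: spec_for_each_sum => i b.
  by do 2 apply: spec_arith; apply: spec_ret.
move=> _ ->; rewrite !add0r.
apply: (spec_bind (P := fun s : 'S_n.+1 =>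
    forall i j : 'I_n.+1, (i <= j)%N -> z (s j) 0 <= z (s i) 0)).
  by move=> c s hs; split; [exact: sort_cost hs | exact: sortP hs].
move=> s hs.
do 3 apply: spec_arith.
pose p j := z - prefix_mx R s j.
(* After [j] passes, [m] is the best prefix length among 0, ..., [j]. *)
pose Inv j (st : R * R * R * nat) := let: (a, b, D, m) := st in
  [/\ (m <= j)%N, a = \sum_i p j i 0, b = \sum_i p j i 0 ^+ 2,
      D = qdist (p m) & forall l, (l <= j)%N -> qdist (p m) <= qdist (p l)].
have p0 : p 0%N = z.
  by apply/colP => i; rewrite !mxE subr0.
apply: (spec_bind (P := Inv n)).
  apply: spec_for_each_enum.
    move=> i [[[a b] D] m] [lemi -> -> -> minm] /=.
    set i' := widen_ord _ i.
    do 7 apply: spec_arith.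
    apply: spec_less; apply: spec_ret => /=.
    have eA : \sum_l p i l 0 - 1 = \sum_l p i.+1 l 0.
      by rewrite (sum_prefixS _ _ z s i').
    have eB : \sum_l p i l 0 ^+ 2 - 2 * z (s i') 0 + 1 =
        \sum_l p i.+1 l 0 ^+ 2.
      by rewrite (sum_sqr_prefixS _ _ z s i').
    rewrite eA eB -expr2 -/(qdist (p i.+1)).
    case: ltP => hlt; split => //.
    - move=> l; rewrite leq_eqVlt => /orP[/eqP->//|].
      by rewrite ltnS => /minm; apply: le_trans; exact: ltW.
    - exact: leqW.
    - move=> l; rewrite leq_eqVlt => /orP[/eqP->//|].
      by rewrite ltnS => /minm.
  by split; rewrite ?p0 //= => l; rewrite leqn0 => /eqP ->; rewrite p0.
move=> [[[a b] D] m] [lemn _ _ _ minm] /=.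
apply: (spec_bind (P := fun k : 'cV[R]_n.+1 =>
    forall l, k l 0 = r l 0 + prefix_mx R s m l 0)).
  (* [m] depends on the run, so its cost is weakened to [n]. *)
  apply: spec_le (leq_mul lemn (leqnn 1)).
  apply: (spec_for_each_take (fun t (k : 'cV[R]_n.+1) =>
    forall l, k l 0 = r l 0 + prefix_mx R s t l 0)) => //; last first.
    by move=> l; rewrite mxE addr0.
  move=> i k kE /=; apply: spec_arith; apply: spec_ret => l.
  set i' := widen_ord _ i.
  rewrite mxE (prefix_mxS _ _ s i') addrA -kE.
  by case: eqP => [->//|_]; rewrite addr0.
move=> k kE.
apply: (spec_bind (P := fun b => b = 0 + \sum_i k i 0)).
  apply: spec_for_each_sum => i c.
  by apply: spec_arith; apply: spec_ret.
move=> _ ->; rewrite add0r; apply: spec_arith.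
suff H : nearest_point (@An_star R n) y (projQ R n *m k).
  have := spec_for_entries (v := k) (C := 1)
    (f := fun i => sub (k i 0) ((\sum_i k i 0) / n.+1%:R))
    (fun i x => x = (projQ R n *m k) i 0).
  move=> He c x hx; case: (He _ c x hx) => [i|? xE].
    by apply: spec_arith; apply: spec_ret; rewrite projQE.
  by split => //; rewrite (_ : x = projQ R n *m k) //; apply/colP.
split.
  exists (\col_l rho l + prefix_mx int s m) => //; congr (_ *m _).
  by apply/colP => l; rewrite kE rE !mxE intrD; case: ltnP.
move=> _ [u _ <-]; rewrite !enorm_sub_projQ; apply: ler_wsqrtr.
rewrite lerD2r.
(* A competitor [u] for [y] corresponds to [u - rho] for the residue [z]; some prefix of length at
   most [n] does as well, and [m] is the best of these. *)
have [m' lem'n] := qdist_prefix_min _ _ z s (u - \col_l rho l) z_bound hs.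
have -> : z - map_mx intr (u - \col_l rho l) = y - map_mx intr u.
  by apply/colP => l; rewrite !mxE zE rE intrB; ring.
apply: le_trans.
rewrite (_ : y - k = p m); first exact: minm.
by apply/colP => l; rewrite !mxE kE zE !mxE; ring.
Qed.

Theorem mainTheorem1 (R : realType) (sort : sorter)
    (sort_correct : sorts_decreasingly R sort)
    (sort_cost : sorts_in_O_nlogn R sort) :
  (forall (n : nat) (y : 'cV[R]_n.+1), (1 <= n)%N ->
     (exists (c : nat) (x : 'cV[R]_n.+1), runs (procN sort y) c x) /\
     (forall (c : nat) (x : 'cV[R]_n.+1), runs (procN sort y) c x ->
        nearest_point (@An_star R n) y x)) /\
  (exists2 T : nat -> nat, is_O_nlogn R T &
     forall (n : nat) (y : 'cV[R]_n.+1) (c : nat) (x : 'cV[R]_n.+1),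
       (1 <= n)%N -> runs (procN sort y) c x -> (c <= T n)%N).
Proof.
have [T TO Tbound] := sort_cost.
have procP n (y : 'cV[R]_n.+1) := procN_spec R sort (T n.+1) n y sort_correct
  (Tbound n.+1).
split.
  move=> n y _; split; first exact: runs_total.
  by move=> c x /procP[].
exists (fun n => T n.+1 + 16 * n.+1)%N; first exact: is_O_nlogn_succ.
by move=> n y c x _ /procP[].
Qed.
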